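(* Let $n,m\in\mathbb{N}$, and let $X\subset\mathbb{R}^n$, functions $f_1,\dots,f_m$ and a constant $C>0$ satisfy Assumption A of the context; put $f=\sum_{i=1}^m f_i$ and $f^*=\inf_{x\in X} f(x)\in\mathbb{R}\cup\{-\infty\}$. Let $\{x_k\}_{k\ge 0}$ be generated by the incremental cutting-plane algorithm of the context with memory size $W$, step sizes $\{t_k\}$ and evaluation schedule $\{I_k\}$. Assume that every component is evaluated at least once in every $W$ consecutive iterations, i.e. $i\in\bigcup_{l=0}^{W-1} I_{k+l}$ for all $k\ge 0$ and all $i\in\{1,\dots,m\}$, and that the step size is constant: $t_k=t$ for all $k$, where $t>0$. Then: 1. If $f^*=-\infty$, then $\liminf_{k\to\infty} f(x_k)=-\infty$. 2. If $f^*>-\infty$, then $$\liminf_{k\to\infty} f(x_k)\le f^*+2m^2tC^2W+\tfrac12 m^2tC^2 .$$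
   Context: Assumption A: (1) $X\subset\mathbb{R}^n$ is nonempty, closed and convex. (2) For $i=1,\dots,m$, $f_i:\mathbb{R}^n\to\mathbb{R}$ is convex, and is finite and subdifferentiable over $X$. (3) $C>0$ is such that $\|g\|\le C$ for all $i\in\{1,\dots,m\}$, all $x\in X$ and all $g\in\partial f_i(x)$, where $\partial f_i(x)$ is the subdifferential of $f_i$ at $x$ and $\|\cdot\|$ is the Euclidean norm. Incremental cutting-plane algorithm: Select $x_0\in X$, a memory size $W\in\mathbb{N}$, $W\ge1$, step sizes $t_k>0$ ($k\ge 0$) and an evaluation schedule $I_k\subset\{1,\dots,m\}$ ($k\ge 0$). For $k=0,1,2,\dots$: (a) for each $i\in I_k$ evaluate $f_i(x_k)$ and some subgradient $g_i(x_k)\in\partial f_i(x_k)$ (an arbitrary choice); (b) let $x_{k+1}=\arg\min_{x\in X}\breve f_k(x)$ (the unique minimizer), where $$\breve f_k(x)=\sum_{i=1}^m \hat f_{k,i}(x)+\frac{1}{2t_k}\|x-x_k\|^2,$$ $$\hat f_{k,i}(x)=\max_{l\in B_{k,i}}\left\{ f_i(x_{k-l})+g_i(x_{k-l})^T(x-x_{k-l})\right\}\ \text{ if } B_{k,i}\neq\emptyset,\qquad \hat f_{k,i}(x)=0\ \text{ otherwise},$$ $$B_{k,i}=\{l\in\mathbb{Z}\mid 0\le l\le\min\{k,W-1\},\ i\in I_{k-l}\}.$$ *)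

(* Defs.v *)
From HB Require Import structures.
From mathcomp Require Import all_boot all_order all_algebra.
From mathcomp Require Import all_classical all_reals all_analysis.

Set Implicit Arguments.
Unset Strict Implicit.
Unset Printing Implicit Defensive.

Import Order.TTheory GRing.Theory Num.Theory.
Import numFieldNormedType.Exports.

Local Open Scope classical_set_scope.
Local Open Scope ring_scope.

Section Euclidean.
Variables (R : realType) (n : nat).
Implicit Types u v x y g : 'rV[R]_n.

Definition dotv u v : R := \sum_(j < n) u 0 j * v 0 j.

(* The library norm on matrices is the sup norm, hence this definition. Both
   norms induce the product topology carried by 'rV[R]_n. *)
Definition enorm u : R := Num.sqrt (dotv u u).

Definition subdifferential (h : 'rV[R]_n -> R) x : set 'rV[R]_n :=
  [set g | forall y, h x + dotv g (y - x) <= h y].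

Definition argmin (X : set 'rV[R]_n) (h : 'rV[R]_n -> R) : set 'rV[R]_n :=
  [set x | X x /\ forall y, X y -> h x <= h y].

End Euclidean.

Section Problem.
Variables (R : realType) (n m : nat).
Variables (X : set 'rV[R]_n) (f : 'I_m -> 'rV[R]_n -> R).

(* Finiteness of the components is built into their codomain R. *)
Record assumptionA (C : R) : Prop := AssumptionA {
  X_nonempty : X !=set0;
  X_closed : closed X;
  X_convex : convex_set X;
  f_convex : forall i, convex_function setT (f i);
  f_subdifferentiable : forall i x, X x -> subdifferential (f i) x !=set0;
  C_gt0 : 0 < C;
  subgradient_bounded : forall i x g,
    X x -> subdifferential (f i) x g -> enorm g <= C }.

Definition objective (x : 'rV[R]_n) : R := \sum_(i < m) f i x.

Definition optimal_value : \bar R :=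
  ereal_inf [set (objective x)%:E | x in X].

End Problem.

Section Algorithm.
Variables (R : realType) (n m : nat).
Variables (X : set 'rV[R]_n) (f : 'I_m -> 'rV[R]_n -> R).
Variables (W : nat) (t : nat -> R) (I : nat -> {set 'I_m}).
Variable x : nat -> 'rV[R]_n.
(* g k i is the subgradient of f i chosen at iteration k; it is only used, and
   only constrained, when i \in I k. *)
Variable g : nat -> 'I_m -> 'rV[R]_n.

(* The bound l <= W - 1 is carried by the type 'I_W. *)
Definition bundle (k : nat) (i : 'I_m) : {set 'I_W} :=
  [set l : 'I_W | (l <= k)%N && (i \in I (k - l)%N)]%SET.

Definition linearization (j : nat) (i : 'I_m) (y : 'rV[R]_n) : R :=
  f i (x j) + dotv (g j i) (y - x j).

(* The maximum over a nonempty bundle is seeded with a linearization from its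
   elements, so that the result does not depend on the seed. *)
Definition cutting_plane_model (k : nat) (i : 'I_m) (y : 'rV[R]_n) : R :=
  if [pick l in bundle k i] is Some l0 then
    \big[Num.max/linearization (k - l0)%N i y]_(l in bundle k i)
      linearization (k - l)%N i y
  else 0.

Definition proximal_model (k : nat) (y : 'rV[R]_n) : R :=
  \sum_(i < m) cutting_plane_model k i y
  + (2 * t k)^-1 * enorm (y - x k) ^+ 2.

(* The proximal model is strongly convex, so its minimizer over X is unique and
   membership in argmin determines the next iterate. *)
Record incremental_cutting_plane : Prop := IncrementalCuttingPlane {
  memory_ge1 : (1 <= W)%N;
  step_gt0 : forall k, 0 < t k;
  start_in_X : X (x 0%N);
  subgradient_choice : forall k i,
    i \in I k -> subdifferential (f i) (x k) (g k i);
  next_iterate : forall k, argmin X (proximal_model k) (x k.+1) }.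

End Algorithm.

(* Main.v *)
Require Import Defs.
From HB Require Import structures.
From mathcomp Require Import all_boot all_order all_algebra.
From mathcomp Require Import all_classical all_reals all_analysis.
From mathcomp Require Import ring lra zify.

Set Implicit Arguments.
Unset Strict Implicit.
Unset Printing Implicit Defensive.

Import Order.TTheory GRing.Theory Num.Theory.
Import numFieldNormedType.Exports.

Local Open Scope classical_set_scope.
Local Open Scope ring_scope.

(** A proximal step over the bundle model [F] satisfies the three-point
    inequality
      F(p) + |p - x_k|^2 / 2t + |y - p|^2 / 2t <= F(y) + |y - x_k|^2 / 2t
    with p = x_{k+1}. As [F] is [mC]-Lipschitz, taking y = x_k bounds each step by [tmC].
    Once every bundle is nonempty, [F] minorizes [f], and since the active cuts
    were taken at most W - 1 steps before, F(x_{k+1}) falls short of f(x_k) by at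
    most 2 m^2 t C^2 W + m C |x_{k+1} - x_k|. Hence |x_k - y|^2 decreases by at
    least 2t (f(x_k) - f(y) - K) at each step, K being the constant of the
    theorem, so that f(x_k) cannot stay above f(y) + K + e. *)

(** * Euclidean inner product, segments and proximal points *)

Section EuclideanTheory.
Variables (R : realType) (n : nat).
Implicit Types u v w : 'rV[R]_n.

Lemma dotvC u v : dotv u v = dotv v u.
Proof. by apply: eq_bigr => j _; rewrite mulrC. Qed.

Lemma dotvDr u v w : dotv u (v + w) = dotv u v + dotv u w.
Proof. by rewrite -big_split; apply: eq_bigr => j _; rewrite mxE mulrDr. Qed.

Lemma dotvZr a u v : dotv u (a *: v) = a * dotv u v.
Proof. by rewrite mulr_sumr; apply: eq_bigr => j _; rewrite mxE mulrCA. Qed.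

Lemma dotvNr u v : dotv u (- v) = - dotv u v.
Proof. by rewrite -scaleN1r dotvZr mulN1r. Qed.

Lemma dotv_ge0 u : 0 <= dotv u u.
Proof. by apply: sumr_ge0 => j _; rewrite -expr2 sqr_ge0. Qed.

Lemma dotv_eq0 u : dotv u u = 0 -> u = 0.
Proof.
move=> u0; apply/rowP => j; rewrite mxE.
have /psumr_eq0P/(_ u0 j isT)/eqP : forall i, true -> 0 <= u 0 i * u 0 i.
  by move=> i _; rewrite -expr2 sqr_ge0.
by rewrite mulf_eq0 orbb => /eqP.
Qed.

Lemma enorm_ge0 u : 0 <= enorm u.
Proof. exact: sqrtr_ge0. Qed.

Lemma sqr_enorm u : enorm u ^+ 2 = dotv u u.
Proof. by rewrite sqr_sqrtr ?dotv_ge0. Qed.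

Lemma enorm0 : enorm (0 : 'rV[R]_n) = 0.
Proof. by rewrite /enorm -[X in dotv _ X](scale0r 0) dotvZr mul0r sqrtr0. Qed.

Lemma enormN u : enorm (- u) = enorm u.
Proof. by rewrite /enorm dotvNr dotvC dotvNr opprK. Qed.

Lemma enorm_distC u v : enorm (u - v) = enorm (v - u).
Proof. by rewrite -enormN opprB. Qed.

Lemma sqr_enormDZ a u v :
  enorm (u + a *: v) ^+ 2 = enorm u ^+ 2 + 2 * a * dotv u v + a ^+ 2 * enorm v ^+ 2.
Proof.
rewrite !sqr_enorm dotvDr dotvZr (dotvC _ u) (dotvC _ v) !dotvDr !dotvZr.
by rewrite (dotvC v u); ring.
Qed.

Lemma dotv_le_enorm u v : dotv u v <= enorm u * enorm v.
Proof.
have [v0|v_neq0] := eqVneq (enorm v) 0.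
  have -> : v = 0 by apply: dotv_eq0; rewrite -sqr_enorm v0 expr0n.
  by rewrite -(scale0r 0) dotvZr mul0r mulr_ge0 ?enorm_ge0.
have v_gt0 : 0 < enorm v by rewrite lt_neqAle eq_sym v_neq0 enorm_ge0.
(* The vector is the residual of [u] after orthogonal projection onto [v]. *)
have := sqr_ge0 (enorm (u + - (dotv u v / enorm v ^+ 2) *: v)).
rewrite sqr_enormDZ.
have -> : enorm u ^+ 2 + 2 * - (dotv u v / enorm v ^+ 2) * dotv u v
    + (- (dotv u v / enorm v ^+ 2)) ^+ 2 * enorm v ^+ 2
  = enorm u ^+ 2 - (dotv u v / enorm v) ^+ 2 by field.
rewrite subr_ge0 => le_sq; rewrite -ler_pdivrMr//.
by rewrite (le_trans (ler_norm _))// -ler_sqr ?nnegrE ?enorm_ge0// real_normK ?num_real.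
Qed.

Lemma ler_enormD u v : enorm (u + v) <= enorm u + enorm v.
Proof.
rewrite -ler_sqr ?nnegrE ?addr_ge0 ?enorm_ge0// -[v in X in X <= _]scale1r.
by rewrite sqr_enormDZ; have := dotv_le_enorm u v; lra.
Qed.

Lemma ler_enormB u v w : enorm (u - w) <= enorm (u - v) + enorm (v - w).
Proof. by rewrite -[u - w](subrKA v) ler_enormD. Qed.

Lemma dotv_le_mul (C : R) u v : enorm u <= C -> dotv u v <= C * enorm v.
Proof. by move=> uC; rewrite (le_trans (dotv_le_enorm _ _)) ?ler_wpM2r ?enorm_ge0. Qed.

Lemma convex_set_segment (X : set 'rV[R]_n) (a : R) u v :
  convex_set X -> 0 <= a <= 1 -> X u -> X v -> X (u + a *: (v - u)).
Proof.
move=> cX /andP[a0 a1] Xu Xv.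
have a01 : Itv.spec (@Itv.num_sem R) (Itv.Real `[0%Z, 1%Z]) a.
  by rewrite /= /Itv.num_sem/= num_real in_itv/= a0 a1.
have := cX v u (Itv.mk a01) (mem_set Xv) (mem_set Xu).
rewrite inE; congr X; rewrite /conv/=.
by rewrite /unstable.onem scalerBl scale1r scalerBr addrCA.
Qed.

(* Compare the minimizer p with the points p + a (y - p), divide by a, and let
   a tend to 0. *)
Lemma argmin_prox (X : set 'rV[R]_n) (F : 'rV[R]_n -> R) (c : R) x p y :
  convex_set X ->
  (forall a u v, 0 <= a <= 1 -> F (u + a *: (v - u)) <= F u + a * (F v - F u)) ->
  0 <= c ->
  argmin X (fun z => F z + c * enorm (z - x) ^+ 2) p -> X y ->
  F p + c * enorm (p - x) ^+ 2 + c * enorm (y - p) ^+ 2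
    <= F y + c * enorm (y - x) ^+ 2.
Proof.
move=> cX cF c0 [Xp minp] Xy.
have le_slope a : 0 < a -> a <= 1 ->
    F p - F y <= 2 * c * dotv (p - x) (y - p) + a * (c * enorm (y - p) ^+ 2).
  move=> a0 a1; have a01 : 0 <= a <= 1 by rewrite ltW.
  have := minp _ (convex_set_segment cX a01 Xp Xy).
  rewrite addrAC sqr_enormDZ => le_min.
  rewrite -(ler_pM2l a0); have := cF _ p y a01; lra.
(* Expanding the square around [p] cancels [c * enorm (y - p) ^+ 2], which leaves the first-order
   optimality condition at [p]. *)
have -> : y - x = (p - x) + 1 *: (y - p) by rewrite scale1r [RHS]addrC subrKA.
rewrite sqr_enormDZ.
suff : F p - F y <= 2 * c * dotv (p - x) (y - p) by lra.
apply/ler_addgt0Pr => e e0.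
set q := c * _ in le_slope; have q0 : 0 <= q by rewrite mulr_ge0 ?sqr_ge0.
have d0 : 0 < q + e by rewrite ltr_wpDl.
(* This slope parameter is at most 1, and its product with [q] is at most [e]. *)
have := le_slope (e / (q + e)); rewrite divr_gt0// ler_pdivrMr// mul1r lerDr.
move=> /(_ isT q0) /le_trans; apply; rewrite lerD2l mulrAC ler_pdivrMr//.
by rewrite ler_pM2l// lerDl ltW.
Qed.

End EuclideanTheory.

(** The lower limit is the supremum of the infima of the tails, and every tail contains a value at
    most [v + e]. *)
Lemma limn_einf_le (R : realType) (u : nat -> R) (v : R) :
  (forall e N, 0 < e -> exists2 k, (N <= k)%N & u k <= v + e) ->
  (limn_einf (fun k => (u k)%:E) <= v%:E)%E.
Proof.
move=> freq; rewrite limn_einf_lim (cvg_lim _ (@cvg_einfs_sup _ _))//.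
apply: ge_ereal_sup => _ [N _ <-]; apply/lee_addgt0Pr => e e0.
have [k Nk uk] := freq e N e0.
apply: (@le_trans _ _ (u k)%:E); last by rewrite -EFinD lee_fin.
by apply: ereal_inf_lbound; exists k.
Qed.

(** * Cutting-plane models and the length of a proximal step *)

Section CuttingPlanes.
Variables (R : realType) (n m : nat) (X : set 'rV[R]_n).
Variables (f : 'I_m -> 'rV[R]_n -> R) (C : R).
Variables (W : nat) (step : nat -> R) (I : nat -> {set 'I_m}).
Variables (x : nat -> 'rV[R]_n) (g : nat -> 'I_m -> 'rV[R]_n).
Hypothesis assA : assumptionA X f C.
Hypothesis algo : incremental_cutting_plane X f W step I x g.

Local Notation lin := (linearization f x g).
Local Notation model := (cutting_plane_model f W I x g).
Local Notation bundle := (bundle W I).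

Lemma iterate_in_X k : X (x k).
Proof. by case: k => [|k]; [case: algo|have [] := next_iterate algo k]. Qed.

(** In the active case the cut is tight at [y] and below the model everywhere, so its slope is a
    subgradient of the model at [y]. Convexity and the Lipschitz bound then need no further
    reasoning on the maximum. *)
Variant model_spec k i y : R -> Prop :=
| ModelEmpty of bundle k i = finset.set0 & (forall z, model k i z = 0) : model_spec k i y 0
| ModelActive l of l \in bundle k i
    & (forall z, lin (k - l)%N i z <= model k i z) :
    model_spec k i y (lin (k - l)%N i y).

Lemma modelP k i y : model_spec k i y (model k i y).
Proof.
have [/finset.set0Pn[l0 l0B]|] := boolP (bundle k i != finset.set0); last first.
  rewrite negbK => /eqP B0.
  have model0 z : model k i z = 0.
    by rewrite /cutting_plane_model; case: pickP => // l; rewrite B0 inE.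
  by rewrite model0; apply: ModelEmpty.
have lin_le l z : l \in bundle k i -> lin (k - l)%N i z <= model k i z.
  move=> lB; rewrite /cutting_plane_model; case: pickP => [l1 _|/(_ l)]; last by rewrite lB.
  exact: le_bigmax_cond.
have [l lB ->] : exists2 l, l \in bundle k i & model k i y = lin (k - l)%N i y.
  rewrite /cutting_plane_model; case: pickP => [l1 l1B|/(_ l0)]; last by rewrite l0B.
  elim/big_rec: _ => [|l v lB [l2 l2B ->]]; first by exists l1.
  by rewrite /Num.max; case: ifP; [exists l2|exists l].
by constructor => // z; exact: lin_le.
Qed.

Lemma lin_sub j i u v : lin j i u - lin j i v = dotv (g j i) (u - v).
Proof. by rewrite /linearization !dotvDr !dotvNr; ring. Qed.

Lemma bundle_eval k i (l : 'I_W) : l \in bundle k i -> (l <= k)%N /\ i \in I (k - l)%N.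
Proof. by rewrite inE => /andP. Qed.

Lemma enorm_chosen_subgradient j i : i \in I j -> enorm (g j i) <= C.
Proof.
move=> iI; apply: (subgradient_bounded assA (iterate_in_X j)).
exact: (subgradient_choice algo).
Qed.

(** The cut active at the intermediate point is affine and lies below the model at both [u] and
    [v]. *)
Lemma model_convex k i a u v : 0 <= a <= 1 ->
  model k i (u + a *: (v - u)) <= model k i u + a * (model k i v - model k i u).
Proof.
move=> /andP[a0 a1]; case: modelP => [_ model0|l lB lin_le].
  by rewrite !model0 subrr mulr0 addr0.
have := lin_sub (k - l) i (u + a *: (v - u)) u.
rewrite [_ + _ *: _]addrC addrK dotvZr -lin_sub [_ *: _ + _]addrC.
by have := lin_le u; have := lin_le v; nra.
Qed.

Lemma model_lipschitz k i u v : model k i u - model k i v <= C * enorm (u - v).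
Proof.
case: modelP => [_ model0|l lB lin_le].
  by rewrite model0 subrr mulr_ge0 ?enorm_ge0// ltW// (C_gt0 assA).
rewrite (@le_trans _ _ (lin (k - l) i u - lin (k - l) i v)) ?lerD2l ?lerN2//.
by rewrite lin_sub dotv_le_mul// enorm_chosen_subgradient//; have [] := bundle_eval lB.
Qed.

(** Each cut is a subgradient inequality for [f i]. A member of the bundle is required because the
    default value 0 of an empty bundle may exceed [f i y]. *)
Lemma model_minorizes k i y l : l \in bundle k i -> model k i y <= f i y.
Proof.
move=> lB; rewrite /cutting_plane_model; case: pickP => [l0 l0B|/(_ l)]; last by rewrite lB.
have lin_le (j : 'I_W) : j \in bundle k i -> lin (k - j)%N i y <= f i y.
  by move=> /bundle_eval[_ iI]; exact: (subgradient_choice algo).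
by apply: bigmax_le => [|j]; exact: lin_le.
Qed.

Lemma component_lipschitz i u v : X u -> f i u - f i v <= C * enorm (u - v).
Proof.
move=> Xu; have [h hu] := f_subdifferentiable assA i Xu.
have := hu v; have := dotv_le_mul (u - v) (subgradient_bounded assA Xu hu).
by rewrite -[v - u]opprB dotvNr; lra.
Qed.

Lemma model_sum_lipschitz k u v :
  \sum_(i < m) model k i u - \sum_(i < m) model k i v <= m%:R * C * enorm (u - v).
Proof.
rewrite -sumrB -mulrA mulr_natl -[X in _ *+ X](card_ord m) -sumr_const.
by apply: ler_sum => i _; exact: model_lipschitz.
Qed.

Lemma iterate_prox k y : X y ->
  \sum_(i < m) model k i (x k.+1)
    + (2 * step k)^-1 * enorm (x k.+1 - x k) ^+ 2
    + (2 * step k)^-1 * enorm (y - x k.+1) ^+ 2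
  <= \sum_(i < m) model k i y + (2 * step k)^-1 * enorm (y - x k) ^+ 2.
Proof.
apply: (argmin_prox (F := fun z => \sum_(i < m) model k i z)
  (X_convex assA) _ _ (next_iterate algo k)) => [a u v a01|].
  rewrite -sumrB mulr_sumr -big_split/=.
  by apply: ler_sum => i _; exact: model_convex.
by rewrite invr_ge0 mulr_ge0// ltW// (step_gt0 algo).
Qed.

Lemma step_length k : enorm (x k.+1 - x k) <= step k * m%:R * C.
Proof.
have t0 := step_gt0 algo k.
have := iterate_prox k (iterate_in_X k).
have := model_sum_lipschitz k (x k) (x k.+1).
rewrite subrr enorm0 expr0n mulr0 addr0 (enorm_distC (x k)).
have := enorm_ge0 (x k.+1 - x k); set s := enorm _ => s0 lip prox.
have [->|s_neq0] := eqVneq s 0.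
  by rewrite !mulr_ge0 ?ler0n ?ltW// (C_gt0 assA).
have s_gt0 : 0 < s by rewrite lt_neqAle eq_sym s_neq0.
(* At y = x_k both quadratic terms on the left equal s^2 / 2t; together they give s^2 / t, hence the
   bound tmC rather than 2tmC. *)
have : (step k)^-1 * s ^+ 2 <= m%:R * C * s.
  have -> : (step k)^-1 * s ^+ 2
    = (2 * step k)^-1 * s ^+ 2 + (2 * step k)^-1 * s ^+ 2.
    by field; rewrite gt_eqF.
  by lra.
by rewrite expr2 mulrA ler_pM2r// mulrC ler_pdivrMr// mulrC mulrA.
Qed.

(** * Descent under a constant step size *)

Variable t : R.
Hypothesis step_const : forall k, step k = t.

Lemma iterate_drift j l : enorm (x (j + l)%N - x j) <= l%:R * (t * m%:R * C).
Proof.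
elim: l => [|l IHl]; first by rewrite addn0 subrr enorm0 mul0r.
rewrite addnS (le_trans (ler_enormB _ (x (j + l)%N) _))//.
have := step_length (j + l); rewrite step_const -natr1 => ?.
by rewrite mulrDl mul1r addrC lerD.
Qed.

(** The active cut was taken at x_{k-l} with l < W. The drift from x_{k-l} to x_k is paid twice,
    once for the change of [f i] and once for the slope of the cut, hence the factor 2. *)
Lemma model_shortfall k i y : bundle k i != finset.set0 ->
  f i (x k) - (2 * C * (W%:R * (t * m%:R * C)) + C * enorm (y - x k)) <= model k i y.
Proof.
have C0 := C_gt0 assA; have t0 := step_gt0 algo 0; rewrite step_const in t0.
case: modelP => [->|l lB _ _]; first by rewrite eqxx.
have [lk iI] := bundle_eval lB.
have drift : enorm (x k - x (k - l)%N) <= W%:R * (t * m%:R * C).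
  rewrite -{1}(subnK lk) (le_trans (iterate_drift _ _))// ler_wpM2r//.
    by rewrite !mulr_ge0// ltW.
  by rewrite ler_nat ltnW.
have cut : - (C * enorm (y - x (k - l)%N)) <= dotv (g (k - l) i) (y - x (k - l)%N).
  rewrite -[y - _]opprB dotvNr enormN lerN2.
  by rewrite dotv_le_mul// enorm_chosen_subgradient.
have := component_lipschitz i (x (k - l)%N) (iterate_in_X k).
have := ler_enormB y (x k) (x (k - l)%N); rewrite /linearization.
move: drift cut; nra.
Qed.

Hypothesis cover : forall k i, i \in (\bigcup_(l < W) I (k + l)%N)%SET.

Lemma bundle_neq0 k i : (W <= k)%N -> bundle k i != finset.set0.
Proof.
(* The window of W iterations ending at k starts at k + 1 - W; its position l corresponds to the lag
   W - 1 - l, which is [rev_ord l]. *)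
move=> Wk; have /bigcupP[l _ iI] := cover (k.+1 - W) i.
apply/finset.set0Pn; exists (rev_ord l); rewrite inE /=.
have lW := ltn_ord l; apply/andP; split; first by lia.
by have -> : (k - (W - l.+1) = k.+1 - W + l)%N by lia.
Qed.

Let gap : R := 2 * m%:R ^+ 2 * t * C ^+ 2 * W%:R + 2^-1 * m%:R ^+ 2 * t * C ^+ 2.

Lemma iterate_descent k y : (W <= k)%N -> X y ->
  enorm (y - x k.+1) ^+ 2
    <= enorm (y - x k) ^+ 2 - 2 * t * (objective f (x k) - (objective f y + gap)).
Proof.
move=> Wk Xy; have t0 := step_gt0 algo 0; rewrite step_const in t0.
have minor : \sum_(i < m) model k i y <= objective f y.
  apply: ler_sum => i _; have /finset.set0Pn[l lB] := bundle_neq0 i Wk.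
  exact: model_minorizes lB.
set p := x k.+1; set s := enorm (p - x k).
have short : objective f (x k)
    - m%:R * (2 * C * (W%:R * (t * m%:R * C)) + C * s) <= \sum_(i < m) model k i p.
  rewrite mulr_natl -[X in _ *+ X](card_ord m) -sumr_const -sumrB.
  by apply: ler_sum => i _; exact: model_shortfall (bundle_neq0 i Wk).
have := iterate_prox k Xy; rewrite step_const -/p -/s.
set a := enorm _; set b := enorm _ => prox.
have {}prox : 2 * t * \sum_(i < m) model k i p + s ^+ 2 + a ^+ 2
    <= 2 * t * \sum_(i < m) model k i y + b ^+ 2.
  have t2 : 0 < 2 * t by rewrite mulr_gt0.
  rewrite -(ler_pM2l t2) !mulrDr !mulrA divff ?gt_eqF// !mul1r in prox.
  exact: prox.
(* This square gives 2tmCs <= s^2 + (tmC)^2. The proximal term absorbs s^2, and (tmC)^2 divided by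
   2t is the second summand of [gap]. *)
move: (sqr_ge0 (s - t * m%:R * C)) minor short prox.
rewrite -(ler_pM2l t0) -(ler_pM2l t0 (_ - _)) /gap.
set A := \sum_i _; set B := \sum_i _; nra.
Qed.

Lemma iterate_frequently_le y e N : X y -> 0 < e ->
  exists2 k, (N <= k)%N & objective f (x k) <= objective f y + gap + e.
Proof.
move=> Xy e0; have t0 := step_gt0 algo 0; rewrite step_const in t0.
apply: contrapT => never.
(* From [k0] on, all bundles are nonempty and all values are too large, so each step lowers the
   squared distance to [y] by at least [d]. *)
pose k0 := maxn N W; pose d := 2 * t * e.
have d0 : 0 < d by rewrite !mulr_gt0.
have descent j :
    enorm (y - x (k0 + j)%N) ^+ 2 <= enorm (y - x k0) ^+ 2 - j%:R * d.
  elim: j => [|j IHj]; first by rewrite addn0 mul0r subr0.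
  have Wk : (W <= k0 + j)%N by rewrite (leq_trans (leq_maxr N W))// leq_addr.
  have Nk : (N <= k0 + j)%N by rewrite (leq_trans (leq_maxl N W))// leq_addr.
  have large : objective f y + gap + e < objective f (x (k0 + j)%N).
    by rewrite ltNge; apply/negP => small; apply: never; exists (k0 + j)%N.
  have := iterate_descent Wk Xy; rewrite addnS -natr1.
  have : 2 * t * e <= 2 * t * (objective f (x (k0 + j)%N) - (objective f y + gap)).
    by rewrite ler_pM2l ?mulr_gt0//; lra.
  by rewrite -/d; lra.
(* After this many steps the upper bound on the squared distance is negative. *)
have := archi_boundP (divr_ge0 (sqr_ge0 (enorm (y - x k0))) (ltW d0)).
rewrite ltr_pdivrMr// => big.
have := descent (Num.bound (enorm (y - x k0) ^+ 2 / d)).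
by have := sqr_ge0 (enorm (y - x (k0 + Num.bound (enorm (y - x k0) ^+ 2 / d))%N)); lra.
Qed.

Lemma limn_einf_objective_le y : X y ->
  (limn_einf (fun k => (objective f (x k))%:E) <= (objective f y + gap)%:E)%E.
Proof. by move=> Xy; apply: limn_einf_le => e N; exact: iterate_frequently_le. Qed.

End CuttingPlanes.

Theorem proposition2p7 (R : realType) (n m : nat)
    (X : set 'rV[R]_n) (f : 'I_m -> 'rV[R]_n -> R) (C : R)
    (W : nat) (step : nat -> R) (I : nat -> {set 'I_m})
    (x : nat -> 'rV[R]_n) (g : nat -> 'I_m -> 'rV[R]_n) (t : R) :
  assumptionA X f C ->
  incremental_cutting_plane X f W step I x g ->
  (forall (k : nat) (i : 'I_m), i \in (\bigcup_(l < W) I (k + l)%N)%SET) ->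
  0 < t ->
  (forall k : nat, step k = t) ->
  (optimal_value X f = -oo%E ->
     limn_einf (fun k : nat => (objective f (x k))%:E) = -oo%E)
  /\
  ((-oo < optimal_value X f)%E ->
     (limn_einf (fun k : nat => (objective f (x k))%:E) <=
        optimal_value X f
        + (2 * m%:R ^+ 2 * t * C ^+ 2 * W%:R
           + 2^-1 * m%:R ^+ 2 * t * C ^+ 2)%:E)%E).
Proof.
move=> assA algo cover t0 step_const.
have liminf_le := limn_einf_objective_le assA algo step_const cover.
set K := _ + _ in liminf_le *; set L := limn_einf _ in liminf_le *.
(* With the finite [K] moved to the left, the infimum over y in X can be taken; this one inequality
   in the extended reals settles both cases. *)
have le_opt : (L - K%:E <= optimal_value X f)%E.
  apply: le_ereal_inf_tmp => _ [y Xy <-].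
  by rewrite leeBlDr// -EFinD liminf_le.
split=> [optNy|_].
  by move: le_opt; rewrite optNy leeNy_eq; case: L {liminf_le}.
by rewrite -leeBlDr.
Qed.
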